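(* Let $X$ be a topological space. The set $\mathscr{U}_B$ of all units in $B_1(X)$ is open in the $m_B$-topology.
   Context: A Baire one function on a topological space $X$ is a function $f:X\to\mathbb{R}$ that is the pointwise limit of a sequence of continuous real-valued functions on $X$. $B_1(X)$ is the commutative ring, under pointwise operations, of all Baire one functions on $X$. A positive unit of $B_1(X)$ is a unit $u$ of the ring $B_1(X)$ with $u(x)>0$ for all $x\in X$. The $m_B$-topology on $B_1(X)$ is the topology having as an open base the sets $\widetilde{M}(g,u)=\{f\in B_1(X): |f(x)-g(x)|<u(x)\text{ for every }x\in X\}$, where $g\in B_1(X)$ and $u$ is a positive unit of $B_1(X)$. *)

(* Defs.v *)
From HB Require Import structures.
From mathcomp Require Import all_boot all_order all_algebra.
From mathcomp Require Import all_classical all_reals all_analysis.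
Set Implicit Arguments.
Unset Strict Implicit.
Unset Printing Implicit Defensive.
Import Order.TTheory GRing.Theory Num.Theory.
Import numFieldNormedType.Exports.
Local Open Scope classical_set_scope.
Local Open Scope ring_scope.

Definition baire_one (X : topologicalType) (R : realType) : {pred X -> R} :=
  fun f => `[< exists g : nat -> X -> R,
    (forall n, continuous (g n)) /\
    (forall x, g n x @[n --> \oo] --> f x) >].

Section baire_one_closure.
Context (X : topologicalType) (R : realType).
Implicit Types f g : X -> R.

Lemma baire_one_cst (a : R) : cst a \in @baire_one X R.
Proof.
apply/asboolP; exists (fun=> cst a); split=> [n x|x]; exact: cvg_cst.
Qed.

Lemma baire_one_comp (phi : R -> R) f : continuous phi ->
  f \in @baire_one X R -> (phi \o f) \in @baire_one X R.
Proof.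
move=> cphi /asboolP[f_ [cf fl]]; apply/asboolP; exists (fun n => phi \o f_ n).
split=> [n x|x]; first exact: continuous_comp (cf n x) (cphi _).
exact: continuous_cvg (cphi _) (fl x).
Qed.

Lemma baire_oneD f g : f \in @baire_one X R -> g \in @baire_one X R ->
  f + g \in @baire_one X R.
Proof.
move=> /asboolP[f_ [cf fl]] /asboolP[g_ [cg gl]]; apply/asboolP.
exists (fun n => f_ n + g_ n); split=> [n x|x].
  exact: continuousD (cf n x) (cg n x).
exact: cvgD (fl x) (gl x).
Qed.

Lemma baire_oneM f g : f \in @baire_one X R -> g \in @baire_one X R ->
  f * g \in @baire_one X R.
Proof.
move=> /asboolP[f_ [cf fl]] /asboolP[g_ [cg gl]]; apply/asboolP.
exists (fun n => f_ n * g_ n); split=> [n x|x].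
  exact: continuousM (cf n x) (cg n x).
exact: cvgM (fl x) (gl x).
Qed.

Lemma baire_oneN f : f \in @baire_one X R -> - f \in @baire_one X R.
Proof. by apply: (@baire_one_comp -%R) => x; apply: cvgN. Qed.

Lemma baire_one_norm f :
  f \in @baire_one X R -> (fun x => `|f x|) \in @baire_one X R.
Proof. by apply: (@baire_one_comp Num.norm) => x; apply: cvg_norm. Qed.

Lemma baire_one_min f g : f \in @baire_one X R -> g \in @baire_one X R ->
  (f \min g) \in @baire_one X R.
Proof.
move=> Bf Bg.
have -> : f \min g = (f + g - (fun x => `|(f - g) x|)) * cst 2^-1.
  by apply/funext => x /=; rewrite minr_absE.
apply: baire_oneM (baire_one_cst _); apply: baire_oneD; first exact: baire_oneD.
by apply/baire_oneN/baire_one_norm/baire_oneD => //; exact: baire_oneN.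
Qed.

Lemma baire_oneV f : (forall x, f x != 0) ->
  f \in @baire_one X R -> (fun x => (f x)^-1) \in @baire_one X R.
Proof.
move=> f0 /asboolP[f_ [cf fl]]; apply/asboolP.
pose d n x := f_ n x * f_ n x + n.+1%:R^-1 : R.
have d0 n x : d n x != 0.
  by rewrite gt_eqF// ltr_wpDl ?invr_gt0// -expr2 sqr_ge0.
exists (fun n x => f_ n x * (d n x)^-1); split=> [n x|x].
  apply: cvgM; first exact: cf.
  apply: cvgV => //; apply: cvgD; last exact: cvg_cst.
  by apply: cvgM; exact: cf.
have -> : (f x)^-1 = f x * (f x * f x + 0)^-1.
  by rewrite addr0 invfM mulrA divff// mul1r.
apply: cvgM (fl x) _; apply: cvgV; first by rewrite addr0 mulf_neq0.
by apply: cvgD (@cvg_harmonic R); apply: cvgM; exact: fl.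
Qed.

Lemma baire_one_subring_closed : subring_closed (@baire_one X R).
Proof.
split=> [|f g Bf Bg|f g]; [exact: baire_one_cst| |exact: baire_oneM].
exact: baire_oneD (baire_oneN Bg).
Qed.

End baire_one_closure.

Section B1_ring.
Context (X : topologicalType) (R : realType).

Record B1 := MkB1 {
  B1_fun :> X -> R;
  _ : B1_fun \in @baire_one X R }.

HB.instance Definition _ := [isSub for B1_fun].
HB.instance Definition _ := [Choice of B1 by <:].
HB.instance Definition _ :=
  GRing.SubChoice_isSubComPzRing.Build (X -> R) (@baire_one X R) B1
    (@baire_one_subring_closed X R).
HB.instance Definition _ := isPointed.Build B1 0.

End B1_ring.

(* MathComp's [unitRingType] requires 1 != 0, which fails for [B1 X R] when X
   is empty; hence the explicit definition of a unit. *)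
Definition ring_units (A : comPzRingType) : set A :=
  [set u | exists v, u * v = 1].
Arguments ring_units : clear implicits.

Definition positive_unit (X : topologicalType) (R : realType) : set (B1 X R) :=
  [set u | ring_units (B1 X R) u /\ forall x, 0 < u x].

Definition mB_base (X : topologicalType) (R : realType) (g u : B1 X R) :
    set (B1 X R) :=
  [set f | forall x, `|f x - g x| < u x].

Section mB_topology.
Context (X : topologicalType) (R : realType).
Implicit Types f g u v : B1 X R.

Lemma positive_unitP u : positive_unit u <-> forall x, 0 < u x.
Proof.
split=> [[]//|u0]; split=> //.
have Bv : (fun x => (u x)^-1) \in @baire_one X R.
  by apply: baire_oneV => [x|]; [rewrite gt_eqF|exact: valP].
exists (MkB1 Bv); apply/val_inj/funext => x.
have ux0 : u x != 0 by rewrite gt_eqF.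
exact: (mulfV ux0).
Qed.

Let mB_cover :
  \bigcup_(i in [set i : B1 X R * B1 X R | positive_unit i.2])
    mB_base i.1 i.2 = setT.
Proof.
apply/seteqP; split=> // f _; exists (f, 1) => /=; last first.
  by move=> x; rewrite subrr normr0 ltr01.
by apply/positive_unitP => x; exact: ltr01.
Qed.

Let mB_join (i j : B1 X R * B1 X R) f :
  positive_unit i.2 -> positive_unit j.2 ->
  mB_base i.1 i.2 f -> mB_base j.1 j.2 f ->
  exists k : B1 X R * B1 X R, [/\ positive_unit k.2, mB_base k.1 k.2 f &
    mB_base k.1 k.2 `<=` mB_base i.1 i.2 `&` mB_base j.1 j.2].
Proof.
case: i j => [g u] [h v] /= _ _ fgu fhv.
have Bdist g' u' : (fun x => u' x - `|f x - g' x|) \in @baire_one X R.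
  apply: baire_oneD (valP u') _; apply/baire_oneN/baire_one_norm.
  exact: (baire_oneD (valP f) (baire_oneN (valP g'))).
pose w := MkB1 (baire_one_min (Bdist g u) (Bdist h v)).
have w0 x : 0 < w x by rewrite /= lt_min !subr_gt0 fgu fhv.
exists (f, w); split=> /=.
- exact/positive_unitP.
- by move=> x; rewrite subrr normr0; exact: w0.
- move=> e efw; split=> x; have := efw x; rewrite /= lt_min !ltrBrDr;
    case/andP => e1 e2; apply: le_lt_trans (ler_distD (f x) _ _) _ => //.
Qed.

HB.instance Definition _ := isBaseTopological.Build (B1 X R) mB_cover mB_join.

End mB_topology.

(* Main.v *)
(* A Baire one function is a unit exactly when it vanishes nowhere.  If [g]
   vanishes nowhere then [|g|] is a positive unit, and [|f - g| < |g|] forces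
   [f] to vanish nowhere, so the unit [g] has the basic neighbourhood
   M(g, |g|) inside the set of units. *)
Require Import Defs.
From mathcomp Require Import all_boot all_order all_algebra.
From mathcomp Require Import all_classical all_reals all_analysis.
Import Order.TTheory GRing.Theory Num.Theory.
Local Open Scope classical_set_scope.
Local Open Scope ring_scope.

(** The converse direction rests on [baire_oneV]: the pointwise inverse is again Baire one. *)
Lemma ring_units_B1P (R : realType) (X : topologicalType) (f : B1 X R) :
  ring_units (B1 X R) f <-> forall x, f x != 0.
Proof.
split=> [[v fv] x|f0].
  have fvx : f x * v x = 1 by exact: (congr1 (fun h : B1 X R => h x) fv).
  by apply: contra_eq_neq fvx => ->; rewrite mul0r eq_sym oner_eq0.
exists (MkB1 (baire_oneV f0 (valP f))); apply/val_inj/funext => x.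
exact: (mulfV (f0 x)).
Qed.

(** At a zero [x] of [f], membership would read [|g x| < |g x|]. *)
Lemma mB_base_norm_units {R : realType} {X : topologicalType} (g h : B1 X R) :
  (forall x, h x = `|g x|) -> mB_base g h `<=` ring_units (B1 X R).
Proof.
move=> hE f fg; apply/ring_units_B1P => x; apply: contraTneq (fg x) => ->.
by rewrite hE sub0r normrN ltxx.
Qed.

Theorem theorem2p12 (R : realType) (X : topologicalType) :
  open (ring_units (B1 X R)).
Proof.
pose norm (g : B1 X R) : B1 X R := MkB1 (baire_one_norm (valP g)).
(* Open sets are by construction unions of basic sets, so the witness is a set of indices: one pair
   (centre, radius) for each unit [g]. *)
exists [set (g, norm g) | g in ring_units (B1 X R)].
  move=> _ [g /ring_units_B1P g0 <-]; apply/positive_unitP => x.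
  by rewrite /= normr_gt0.
apply/seteqP; split=> [f [_ [g _ <-]]|g Ug].
  exact: mB_base_norm_units.
exists (g, norm g); first by exists g.
by move/ring_units_B1P: Ug => g0 /= x; rewrite subrr normr0 /= normr_gt0.
Qed.
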